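(* (i) For any function $l=l(s)$ taking nonnegative integer values with $l(s)\leq\frac{\ln s}{6\ln 3}$, one has $\mathrm{SCN}(2s+1,(s+1)^2+l)=s+2$ for all sufficiently large $s$. (ii) For any such function $l=l(s)\leq \frac{\ln s}{6\ln 3}$, one has $\mathrm{SCN}(2s,s(s+1)+l)=s+2$ for all sufficiently large $s$.
   Context: Let $v,N,t$ be positive integers and $[v]=\{1,\dots,v\}$. An $N\times v$ array $C$ whose rows are permutations of $[v]$ is an $(N,v,t)$-suitable core if the following holds: choose $N$ new distinct symbols, prepend a different one of them to each row of $C$, and append the remaining $N-1$ new symbols (in arbitrary order) to that row; the resulting $N\times(v+N)$ array has the property that for every $t$-element subset $S$ of the $v+N$ symbols and every $\sigma\in S$ there is a row in which $\sigma$ occurs before every element of $S\setminus\{\sigma\}$. (Equivalently: for every symbol $\sigma\in[v]$ and every subset $T\subseteq[v]\setminus\{\sigma\}$, the number of rows of $C$ in which $\sigma$ precedes every element of $[v]\setminus(T\cup\{\sigma\})$ is at least $t+1-v+|T|$.) For positive integers $t,N$, $\mathrm{SCN}(t,N)$ denotes the largest $v$ for which an $(N,v,t)$-suitable core exists. *)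

(* Defs.v *)
From mathcomp Require Import all_boot all_order all_fingroup.

Set Implicit Arguments.
Unset Strict Implicit.
Unset Printing Implicit Defensive.

Definition suitable (W : finType) (N t : nat) (A : 'I_N -> seq W) : Prop :=
  forall (S : {set W}) (x : W), #|S| = t -> x \in S ->
    exists i : 'I_N, forall y : W, y \in S :\ x ->
      index x (A i) < index y (A i).

(* C i j is the entry of C in row i and column j. The old symbols are
   inl k, the new ones inr k. The new symbol prepended to row i is p i, and
   r i lists the other new symbols, in the order in which they are appended. *)
Definition extension (N v : nat) (C : 'I_N -> {perm 'I_v})
    (p : {perm 'I_N}) (r : 'I_N -> seq 'I_N) (i : 'I_N) : seq ('I_v + 'I_N) :=
  inr (p i) :: [seq inl (C i j) | j <- enum 'I_v] ++ [seq inr k | k <- r i].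

Definition suitable_core (N v t : nat) (C : 'I_N -> {perm 'I_v}) : Prop :=
  forall (p : {perm 'I_N}) (r : 'I_N -> seq 'I_N),
    (forall i, perm_eq (p i :: r i) (enum 'I_N)) ->
    suitable t (extension C p r).

Definition has_suitable_core (N v t : nat) : Prop :=
  exists C : 'I_N -> {perm 'I_v}, suitable_core t C.

(* SCN(t, N) = v *)
Definition is_SCN (t N v : nat) : Prop :=
  [/\ 0 < v, has_suitable_core N v t
    & forall v' : nat, 0 < v' -> has_suitable_core N v' t -> v' <= v].

(* Main.v *)
Require Import Defs.
From mathcomp Require Import all_boot all_order all_algebra all_fingroup.
From mathcomp Require Import reals exp.
From mathcomp Require Import zify.

(* A core on [v] symbols is characterised by: for every symbol [x] and every
   set [U] of other old symbols, [x] precedes all of [U] in at least [t - #|U|]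
   rows.

   For [v = s + 2], take one row per pair [(a, b)], [a != b], [b \notin Z],
   starting with [a], [b], where [Z] has one (t odd) or two (t even) elements;
   these come next in the row.

   For [v = s + 3], put [m = t + 1 - v]: every symbol leads at least [m] rows and
   [N = m v + e] with [e = l + O(1)], so all but at most [e] "bad" symbols lead
   exactly [m]. If [a], [b] are good, some row starts with [a], [b]. This leaves so
   few other rows led by [a] that at least three bad symbols are not the first
   bad symbol of any of them, and by pigeonhole many good [a] share three such
   symbols. For a pair [{a, b}] of these, one of the three is not the first bad
   symbol in the chosen rows of [(a, b)] and [(b, a)]; colour the pair with it.
   A set [T], monochromatic in colour [c] and larger than the excess of [c], then
   contradicts the characterisation for [c] and the complement of [c |: T]. Ramsey's
   theorem yields [T] as soon as [s] is exponentially large in [e]. *)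

Set Implicit Arguments.
Unset Strict Implicit.
Unset Printing Implicit Defensive.

Import GRing.Theory Num.Theory.

(** * Subsets of given size, pigeonhole and Ramsey's theorem *)

Lemma exists_subset_card (T : finType) (A : {set T}) k :
  k <= #|A| -> exists2 B : {set T}, B \subset A & #|B| = k.
Proof.
elim: k => [|k IHk] leA; first by exists set0; rewrite ?sub0set ?cards0.
have [B sBA cB] := IHk (ltnW leA).
have /card_gt0P[x] : 0 < #|A :\: B| by rewrite cardsDS // cB subn_gt0.
rewrite inE => /andP[xB xA]; exists (x |: B); last by rewrite cardsU1 xB cB.
by rewrite subUset sub1set xA.
Qed.

Lemma exists_superset_card (T : finType) (A : {set T}) k :
  #|A| <= k -> k <= #|T| -> exists2 B : {set T}, A \subset B & #|B| = k.
Proof.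
move=> leA lek; have [|B sB cB] := @exists_subset_card T (~: A) (#|T| - k).
  by rewrite cardsCs setCK leq_sub2l.
exists (~: B); first by rewrite -(setCK A) setCS.
by rewrite cardsCs setCK cB subKn.
Qed.

Lemma pigeonhole_card (T U : finType) (A : {set T}) (B : {set U}) (f : T -> U) n :
    {in A, forall x, f x \in B} -> 0 < #|A| -> #|B| * n <= #|A| ->
  exists2 y, y \in B & n <= #|[set x in A | f x == y]|.
Proof.
move=> fB A0 leA; case: n leA => [_|n leA].
  by have /card_gt0P[x xA] := A0; exists (f x); rewrite ?fB.
have [/existsP[y /andP[yB le]]|/existsPn small] :=
  boolP [exists y in B, n < #|[set x in A | f x == y]|]; first by exists y.
have : #|A| <= #|B| * n.
  rewrite -sum1_card (partition_big f (mem B)) //= -sum_nat_const.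
  apply: leq_sum => y yB; have := small y; rewrite yB -leqNgt /=.
  by apply: leq_trans; rewrite -sum1_card; apply/eq_leq/eq_bigl => x; rewrite inE.
have /card_gt0P[x xA] := A0.
have : 0 < #|B| by apply/card_gt0P; exists (f x); apply: fB.
move: leA; rewrite mulnS; lia.
Qed.

(** By induction on the sum of the [k j]: some colour [j] joins a vertex [x] to at least [#|D| ^ n]
    others, and a [j]-clique of size [k j - 1] among these is completed by [x]. The relations may
    overlap, so a pair can carry several colours. *)
Lemma multicolor_ramsey (V K : finType) (D : {set K}) (r : K -> rel V)
    (k : K -> nat) (A : {set V}) :
    (forall j, symmetric (r j)) ->
    {in A &, forall x y, x != y -> exists2 j, j \in D & r j x y} ->
    1 < #|D| -> #|D| ^ (\sum_(j in D) k j) <= #|A| ->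
  exists j, exists T : {set V}, [/\ j \in D, T \subset A, #|T| = k j
    & {in T &, forall x y, x != y -> r j x y}].
Proof.
move=> r_sym + D1; have D0 := ltnW D1; move defn : (\sum_(j in D) k j) => n.
elim: n k A defn => [|n IHn] k A defn cover leA.
  have /card_gt0P[j jD] := D0; exists j, set0.
  split=> //; rewrite ?sub0set ?cards0 //; last by move=> x y; rewrite inE.
  by apply/esym/eqP; move/eqP: defn; rewrite sum_nat_eq0 => /forall_inP; apply.
have [/existsP[j /andP[jD /eqP kj]]|/existsPn kpos] := boolP [exists j in D, k j == 0].
  exists j, set0; split=> //; rewrite ?sub0set ?cards0 //.
  by move=> x y; rewrite inE.
have /card_gt0P[x xA] : 0 < #|A| by apply: leq_trans leA; rewrite expn_gt0 D0.
have [/existsP[j /andP[jD le]]|/existsPn small] :=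
  boolP [exists j in D, #|D| ^ n <= #|[set y in A :\ x | r j x y]|]; last first.
  (* If every colour fell short at [x], then [#|A| - 1] would be at most [#|D| ^ n.+1 - #|D|], which
     is too small since [1 < #|D|]. *)
  have : #|A :\ x| <= #|D| * (#|D| ^ n).-1.
    apply: (@leq_trans (\sum_(j in D) #|[set y in A :\ x | r j x y]|)).
      apply: (@leq_trans #|\bigcup_(j in D) [set y in A :\ x | r j x y]|).
        apply/subset_leq_card/subsetP => y yA.
        have [yx y'A] := setD1P yA.
        have [j jD rj] := cover x y xA y'A (contra_neq (@esym _ _ _) yx).
        by apply/bigcupP; exists j; rewrite // inE yA.
      elim/big_rec2: _ => [|j s S jD le]; first by rewrite cards0.
      by apply: leq_trans (leq_card_setU _ _) _; rewrite leq_add2l.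
    rewrite -sum_nat_const; apply: leq_sum => j jD.
    by have := small j; rewrite jD /=; lia.
  have : 0 < #|D| ^ n by rewrite expn_gt0 D0.
  move: leA; rewrite (cardsD1 x A) xA expnS.
  case: (#|D| ^ n) => // p leA _; rewrite /= => leA'.
  by move: leA; rewrite mulnS; lia.
have kj : 0 < k j by have := kpos j; rewrite jD /= lt0n.
pose k' i := if i == j then (k j).-1 else k i.
have [||i [T [iD sT cT rT]]] := IHn k' _ _ _ le.
- have : \sum_(i in D | i != j) k' i = \sum_(i in D | i != j) k i.
    by apply: eq_bigr => i /andP[_ /negPf ij]; rewrite /k' ij.
  move: defn; rewrite !(bigD1 j jD) => defn /= ->; rewrite /k' eqxx.
  by apply/eqP; rewrite -eqSS -defn -addSn prednK.
- by move=> y z; rewrite !inE => /andP[/andP[_ ? _]] /andP[/andP[_ ? _]]; apply: cover.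
have sTA : T \subset A by apply: subset_trans sT _; apply/subsetP=> y; rewrite !inE => /andP[/andP[]].
have [eij|nij] := eqVneq i j; last by exists i, T; split; rewrite // cT /k' (negPf nij).
have rx y : y \in T -> r j x y by move/(subsetP sT); rewrite inE => /andP[].
exists j, (x |: T); split=> //; first by rewrite subUset sub1set xA.
  rewrite cardsU1 cT /k' eij eqxx; case: (boolP (x \in T)) => [/(subsetP sT)|_].
    by rewrite !inE eqxx.
  by rewrite add1n prednK.
move=> y z /setU1P[->|yT] /setU1P[->|zT]; rewrite ?eqxx // => nyz.
- exact: rx.
- by rewrite r_sym; apply: rx.
- by rewrite -eij; apply: rT.
Qed.

(** * Non-existence of dense rankings *)

(* A row is encoded by the position [rk i x] of each symbol [x] in it. *)
Definition rows_before (I V : finType) (rk : I -> V -> nat) (x : V)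
    (U : {set V}) : {set I} :=
  [set i | [forall y in U, rk i x < rk i y]].

Lemma rows_beforeP (I V : finType) (rk : I -> V -> nat) x (U : {set V}) i :
  reflect {in U, forall y, rk i x < rk i y} (i \in rows_before rk x U).
Proof. by rewrite inE; apply: forall_inP. Qed.

Definition argminset (V : finType) (A : {set V}) (x0 : V) (f : V -> nat) : V :=
  [arg min_(x < x0 in A) f x].

Lemma mem_argminset (V : finType) (A : {set V}) x0 f :
  x0 \in A -> argminset A x0 f \in A.
Proof. by rewrite /argminset => x0A; case: arg_minnP. Qed.

Lemma argminset_eq (V : finType) (A : {set V}) x0 f y :
    x0 \in A -> y \in A -> {in A, forall z, z != y -> f y < f z} ->
  argminset A x0 f = y.
Proof.
rewrite /argminset => x0A yA lt; case: arg_minnP => // z zA le.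
by apply: contraTeq (le y yA) => zy; rewrite -ltnNge lt.
Qed.

Lemma argminset_le (V : finType) (A : {set V}) x0 f y :
  x0 \in A -> y \in A -> f (argminset A x0 f) <= f y.
Proof. by rewrite /argminset => x0A yA; case: arg_minnP => // z _; apply. Qed.

Lemma exists_notin (T : finType) (A B : {set T}) :
  #|B| < #|A| -> exists2 x, x \in A & x \notin B.
Proof. by move=> lt; apply/subsetPn; apply: contraL lt => /subset_leq_card; rewrite -leqNgt. Qed.

(** The refuted condition is the characterisation of cores for [U] the complement of [x |: T], with
    [m = t + 1 - #|V|]. The bound [m + 4 <= #|V|] yields the three bad symbols; [3 ^ (2 * e + 3)]
    pays for a pigeonhole over at most [2 ^ e] sets, then for Ramsey with three colours and total
    size at most [e + 3]. *)
Lemma no_dense_ranking (I V : finType) (rk : I -> V -> nat) m e :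
    #|I| <= m * #|V| + e -> m + 4 <= #|V| -> 3 ^ (2 * e + 3) <= #|V| ->
  ~ (forall x (T : {set V}), x \notin T ->
       m + #|T| <= #|rows_before rk x (~: (x |: T))|).
Proof.
move=> leI lem lee dense.
have /card_gt0P[x0 _] : 0 < #|V| by lia.
pose hd i := argminset [set: V] x0 (rk i).
pose lead x := [set i | hd i == x].
have before_lead x T i : i \in rows_before rk x (~: (x |: T)) -> i \notin lead x -> hd i \in T.
  move=> /rows_beforeP lt; rewrite inE => hx; apply: contraT => hT.
  have := lt (hd i); rewrite !inE negb_or hx hT => /(_ isT).
  by rewrite ltnNge argminset_le ?inE.
have lead_ge x : m <= #|lead x|.
  have := dense x set0; rewrite inE cards0 addn0 => /(_ isT)/leq_trans; apply.
  apply/subset_leq_card/subsetP => i /before_lead h.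
  by apply: contraT => /h; rewrite inE.
pose ex x := #|lead x| - m.
have sum_ex : \sum_x ex x <= e.
  have : \sum_x #|lead x| = #|I|.
    rewrite -sum1_card (partition_big hd predT) //=; apply: eq_bigr => x _.
    by rewrite -sum1_card; apply: eq_bigl => i; rewrite inE.
  have -> : \sum_x #|lead x| = \sum_x (ex x + m).
    by apply: eq_bigr => x _; rewrite subnK.
  rewrite big_split sum_nat_const mulnC /= addnC => sumI.
  by move: leI; rewrite -sumI leq_add2l.
pose B := [set x | m < #|lead x|]; pose G := ~: B.
have cB : #|B| <= e.
  apply: leq_trans sum_ex; rewrite -sum1_card [leqRHS](bigID (mem B)) /=.
  apply: leq_trans (leq_addr _ _); apply: leq_sum => x.
  by rewrite inE /ex subn_gt0.
have leadG x : x \in G -> #|lead x| = m.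
  by rewrite !inE -leqNgt => le; apply/eqP; rewrite eqn_leq le lead_ge.
have cBG : #|B| + #|G| = #|V| by rewrite cardsC.
have G0 : 3 ^ (e + 3) * 2 ^ #|B| <= #|G|.
  have : 3 ^ (e + 3) * 2 ^ #|B| + e <= 3 ^ (2 * e + 3).
    have : 2 ^ #|B| + e <= 3 ^ e.
      apply: (@leq_trans (2 ^ e + e)); first by rewrite leq_add2r leq_exp2l.
      by elim: (e) => // k; rewrite !expnS; have := ltn_expl k (isT : 1 < 2); lia.
    have -> : 2 * e + 3 = (e + 3) + e by lia.
    rewrite (expnD 3 (e + 3)) => le; apply: leq_trans (leq_mul (leqnn _) le).
    by rewrite mulnDr leq_add2l leq_pmull // expn_gt0.
  by lia.
have Gpos : 0 < #|G| by apply: leq_trans G0; rewrite muln_gt0 !expn_gt0.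
(* At least [m + 1] rows put [s] before everything but [t], and [s] leads only [m] rows; in a
   remaining one [t] is first and [s] second. *)
have ex_row t s : t \in G -> s \in G -> t != s ->
    exists2 i, i \in lead t & i \in rows_before rk s (~: (s |: [set t])).
  move=> tG sG ts.
  have [|i iR iL] := @exists_notin _ (rows_before rk s (~: (s |: [set t]))) (lead s).
    have := dense s [set t]; rewrite inE eq_sym cards1 leadG // => /(_ ts); lia.
  by exists i => //; have := before_lead _ _ _ iR iL; rewrite !inE.
have [t0 t0G] : exists t, t \in G by apply/card_gt0P.
(* [i0] is the default of [row], never reached for distinct good symbols. *)
have [i0 _] : exists i, i \in I.
  have [x] : exists x, x \in [set~ t0] by apply/card_gt0P; rewrite cardsC1; lia.
  rewrite !inE => xt; have := dense t0 [set x]; rewrite inE eq_sym cards1 => /(_ xt).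
  by case: (set_0Vmem (rows_before rk t0 (~: (t0 |: [set x])))) => [->|[i]];
    [rewrite cards0; lia|exists i].
pose row t s := odflt i0 [pick i in lead t :&: rows_before rk s (~: (s |: [set t]))].
have rowP t s : t \in G -> s \in G -> t != s ->
    row t s \in lead t /\ row t s \in rows_before rk s (~: (s |: [set t])).
  move=> tG sG ts; rewrite /row; case: pickP => [i /setIP[]//|no].
  by have [i it is_] := ex_row t s tG sG ts; have := no i; rewrite inE it is_.
(* [lead t :\: P t] is small, as [P t] already has [#|G| - 1] rows. *)
pose P t := row t @: (G :\ t).
have cP t : t \in G -> #|P t| = #|G|.-1.
  move=> tG; rewrite (cardsD1 t G) tG add1n /=; apply: card_in_imset => s s'.
  move=> /setD1P[st sG] /setD1P[s't s'G] erow; apply: contra_eq (erefl true) => ss'.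
  have [_ /rows_beforeP lt1] : _ := rowP t s tG sG (contra_neq (@esym _ _ _) st).
  have [_ /rows_beforeP lt2] : _ := rowP t s' tG s'G (contra_neq (@esym _ _ _) s't).
  (* A common row of two pairs would have [s] before [s'] and [s'] before [s]. *)
  have := lt1 s'; rewrite !inE negb_or s't (eq_sym s') ss' => /(_ isT).
  by have := lt2 s; rewrite -erow !inE negb_or st ss' => /(_ isT); lia.
have cE t : t \in G -> #|lead t :\: P t| + #|G|.-1 = m.
  move=> tG; rewrite -(cP t tG) -(leadG t tG) cardsDS.
    rewrite subnK // subset_leq_card //; apply/subsetP => i /imsetP[s /setD1P[st sG] ->].
    by have [] := rowP t s tG sG (contra_neq (@esym _ _ _) st).
  apply/subsetP => i /imsetP[s /setD1P[st sG] ->].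
  by have [] := rowP t s tG sG (contra_neq (@esym _ _ _) st).
(* [cE] forces [#|G| <= m + 1], hence [#|G| <= #|V| - 3]. *)
have [b0 b0B] : exists b, b \in B by apply/card_gt0P; have := cE t0 t0G; lia.
(* the first bad symbol of row [i] *)
pose fb i := argminset B b0 (rk i).
pose X t := fb @: (lead t :\: P t).
have XB t : X t \in powerset B.
  by rewrite inE; apply/subsetP => b /imsetP[i _ ->]; apply: mem_argminset.
have [|X0 X0B leG'] := @pigeonhole_card _ _ G (powerset B) X (3 ^ (e + 3)) (fun t _ => XB t) Gpos.
  by rewrite card_powerset mulnC.
set G' := [set t in G | X t == X0] in leG'.
have [t1 t1G'] : exists t, t \in G'.
  by apply/card_gt0P; apply: leq_trans leG'; rewrite expn_gt0.
(* [X0] has at most [m + 1 - #|G|] elements, hence at most [#|B| - 3]. *)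
have [D sD cD] : exists2 D : {set V}, D \subset B :\: X0 & #|D| = 3.
  apply: exists_subset_card; rewrite cardsDS; last by rewrite inE in X0B.
  have [t1G /eqP <-] : t1 \in G /\ X t1 == X0 by apply/andP; move: t1G'; rewrite inE.
  have := leq_imset_card fb (lead t1 :\: P t1); have := cE t1 t1G.
  rewrite -/(X t1); lia.
pose r b t s := (fb (row t s) != b) && (fb (row s t) != b).
have [|t s _ _ ts|||b [T [bD sT cT rT]]] := @multicolor_ramsey V V D r (fun b => (ex b).+1) G'.
- by move=> b t s; rewrite /r andbC.
- have [|b bD] := @exists_notin _ D [set fb (row t s); fb (row s t)].
    by rewrite cD cards2; case: (_ != _).
  by rewrite !inE negb_or => nb; exists b; rewrite // /r eq_sym andbC eq_sym andbC.
- by rewrite cD.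
- apply: leq_trans leG'; rewrite cD leq_exp2l //.
  under eq_bigr do rewrite -addn1; rewrite big_split /= sum_nat_const cD muln1 leq_add2r.
  by apply: leq_trans sum_ex; rewrite [leqRHS](bigID (mem D)) /= leq_addr.
have [bB bX] := setDP (subsetP sD b bD).
have TG t : t \in T -> t \in G by move/(subsetP sT); rewrite inE => /andP[].
have bT : b \notin T by apply/negP => /TG; rewrite inE bB.
(* [#|T|] is the excess of [b] plus one, so these rows outnumber those led by [b]. *)
have [|i iR iL] := @exists_notin _ (rows_before rk b (~: (b |: T))) (lead b).
  have := dense b T bT; have := lead_ge b; rewrite cT /ex; lia.
have tT := before_lead _ _ _ iR iL; set t := hd i in tT.
have fbi : fb i = b.
  apply: argminset_eq => // z zB zb; have /rows_beforeP := iR; apply.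
  by rewrite !inE negb_or zb; apply: contraL zB => /TG; rewrite inE.
have /eqP XtX0 : X t == X0 by move/(subsetP sT): tT; rewrite inE => /andP[].
have it : i \in lead t by rewrite inE.
(* Row [i] starts with [t] and has first bad symbol [b]. Outside [P t] it would put [b] in [X0].
   Otherwise it is the row of some [(t, s)]: [s] in [T] contradicts the colour of [{t, s}], and [s]
   outside [T] would come both before and after [b]. *)
have [/imsetP[s /setD1P[st sG] irow]|iP] := boolP (i \in P t); last first.
  by move/negP: bX; apply; rewrite -XtX0 -fbi; apply: imset_f; rewrite inE iP.
have [sT'|sT'] := boolP (s \in T).
  by have := rT t s tT sT'; rewrite eq_sym st /r -irow fbi eqxx => /(_ isT).
have bs : b != s by apply: contraTneq sG => <-; rewrite inE bB.
have [_] := rowP t s (TG t tT) sG (contra_neq (@esym _ _ _) st).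
rewrite -irow => /rows_beforeP/(_ b); rewrite !inE negb_or bs (contraNneq _ bT) => [|->//].
have /rows_beforeP/(_ s) := iR; rewrite !inE negb_or eq_sym bs sT'.
by move=> /(_ isT) lt1 /(_ isT) lt2; have := ltn_trans lt1 lt2; rewrite ltnn.
Qed.

(** * Cores in terms of row counts *)

Definition core_rank (N v : nat) (C : 'I_N -> {perm 'I_v}) (i : 'I_N) (x : 'I_v) : nat :=
  ((C i)^-1)%g x.

Lemma index_extension_old N v (C : 'I_N -> {perm 'I_v}) (p : {perm 'I_N}) r i x :
  index (inl x) (extension C p r i) = (core_rank C i x).+1.
Proof.
have inl_inj : injective (fun j => inl (C i j) : 'I_v + 'I_N).
  by move=> a b [] /perm_inj.
rewrite /extension /= -[in LHS](permKV (C i) x) index_cat.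
by rewrite mem_map ?mem_enum //= index_map // index_enum_ord.
Qed.

Lemma index_extension_head N v (C : 'I_N -> {perm 'I_v}) (p : {perm 'I_N}) r i :
  index (inr (p i)) (extension C p r i) = 0.
Proof. by rewrite /= eqxx. Qed.

Lemma index_extension_tail N v (C : 'I_N -> {perm 'I_v}) (p : {perm 'I_N}) r i k :
  k != p i -> v < index (inr k) (extension C p r i).
Proof.
move=> kp; rewrite /extension /= ifF; last by apply/negbTE; apply: contra_neq kp => -[].
rewrite index_cat ifF; first by rewrite size_map size_enum_ord ltnS leq_addr.
by apply/negP => /mapP[].
Qed.

(** A new symbol is first in its own row and follows all old symbols elsewhere. So [x] beats [U] and
    a set [W] of new symbols exactly in the rows of [rows_before] not headed by [W]. The critical
    size of [W] is [t - 1 - #|U|], which [t <= N.+1] keeps within [N]. *)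
Lemma suitable_coreP N v t (C : 'I_N -> {perm 'I_v}) :
    t <= N.+1 ->
  suitable_core t C <->
  (forall x (U : {set 'I_v}), x \notin U ->
     t <= #|U| + #|rows_before (core_rank C) x U|).
Proof.
move=> leN; split=> [coreC x U xU | dense p r _ S x cS xS].
- rewrite leqNgt; apply/negP => few.
  (* [W] contains every row in which [x] precedes [U]; with [p = 1] below, each of these rows is
     headed by a symbol of [W]. *)
  have [||W sW cW] := @exists_superset_card _ (rows_before (core_rank C) x U) (t - #|U|.+1).
  + by move: few; lia.
  + by rewrite card_ord; lia.
  pose S := (inl @: (x |: U)) :|: (inr @: W) : {set 'I_v + 'I_N}.
  have inl_S y : (inl y \in S) = (y \in x |: U).
    rewrite inE mem_imset; last by move=> ? ? [].
    by case: imsetP => [[]//|_]; rewrite orbF.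
  have inr_S k : (inr k \in S) = (k \in W).
    rewrite inE orbC mem_imset; last by move=> ? ? [].
    by case: imsetP => [[]//|_]; rewrite orbF.
  have cS : #|S| = t.
    rewrite cardsU !card_imset; try by move=> ? ? [].
    rewrite cardsU1 xU cW (_ : _ :&: _ = set0) ?cards0; first by move: few; lia.
    by apply/setP => y; rewrite !inE; apply/negP => /andP[/imsetP[? _ ->] /imsetP[]].
  have [||i lt] := coreC 1%g (fun i => rem i (enum 'I_N)) _ S (inl x) cS.
  + by move=> i; rewrite perm1 perm_sym perm_to_rem ?mem_enum.
  + by rewrite inl_S setU11.
  have iR : i \in rows_before (core_rank C) x U.
    apply/rows_beforeP => y yU; have := lt (inl y).
    rewrite !index_extension_old ltnS; apply; rewrite !inE -in_setU inl_S setU1r // andbT.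
    by apply: contraTneq yU => -[->].
  have := lt (inr i); rewrite !inE -in_setU inr_S (subsetP sW) // => /(_ isT).
  by rewrite -{2}(perm1 i) index_extension_head.
- case: x xS => [x|k] xS; last first.
    exists ((p^-1)%g k) => y; rewrite -{1 2}(permKV p k) index_extension_head.
    case: y => [y|k'] /setD1P[ne _]; first by rewrite index_extension_old.
    apply: leq_ltn_trans (index_extension_tail _ _ _) => //.
  pose U := [set y | (y != x) && (inl y \in S)]; pose W := [set k | inr k \in S].
  have cSUW : t = (#|U| + #|W|).+1.
    rewrite -cS (cardsD1 (inl x) S) xS add1n; congr _.+1.
    have -> : S :\ inl x = (inl @: U) :|: (inr @: W).
      apply/setP => -[y|k]; rewrite !inE.
        rewrite mem_imset ?inE => [|? ? []//]; case: imsetP => [[]//|_].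
        by rewrite orbF; congr (~~ _ && _); apply/eqP/eqP => [[]|->].
      rewrite orbC mem_imset ?inE => [|? ? []//]; case: imsetP => [[]//|_].
      by rewrite orbF.
    rewrite cardsU !card_imset; try by move=> ? ? [].
    rewrite (_ : _ :&: _ = set0) ?cards0 ?subn0 //.
    by apply/setP => y; rewrite !inE; apply/negP => /andP[/imsetP[? _ ->] /imsetP[]].
  have xU : x \notin U by rewrite inE eqxx.
  have [|i iR iW] := @exists_notin _ (rows_before (core_rank C) x U) (p @^-1: W).
    have := dense x U xU; rewrite card_preimset; last exact: perm_inj.
    by rewrite cSUW -addnS leq_add2l.
  exists i => -[y|k] /setD1P[ne yS]; rewrite index_extension_old.
    rewrite index_extension_old ltnS; have /rows_beforeP := iR; apply.
    by rewrite inE yS andbT; apply: contra_neq ne => ->.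
  apply: leq_ltn_trans (index_extension_tail _ _ _); first exact: ltn_ord.
  by apply: contraNneq iW => kp; rewrite !inE -kp.
Qed.

(** Deleting old symbols keeps the counts but leaves gaps in the positions, hence rankings instead
    of permutations. This reduces every size above [s + 2] to [s + 3]. *)
Lemma core_restrict N v t (C : 'I_N -> {perm 'I_v}) w :
    t <= N.+1 -> w <= v -> suitable_core t C ->
  exists rk : 'I_N -> 'I_w -> nat,
    forall x (U : {set 'I_w}), x \notin U -> t <= #|U| + #|rows_before rk x U|.
Proof.
move=> leN lewv /(suitable_coreP _ leN) dense.
exists (fun i x => core_rank C i (widen_ord lewv x)) => x U xU.
have inj : injective (widen_ord lewv) by move=> a b /(congr1 val) /= /val_inj.
have := dense (widen_ord lewv x) (widen_ord lewv @: U).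
rewrite mem_imset // xU card_imset // => /(_ isT)/leq_trans; apply.
rewrite leq_add2l; apply/subset_leq_card/subsetP => i /rows_beforeP lt.
by apply/rows_beforeP => y yU; apply: lt; apply: imset_f.
Qed.

Lemma core_size_bound N v t w m e :
    t <= N.+1 -> w <= v -> m + w = t.+1 -> N <= m * w + e -> m + 4 <= w ->
    3 ^ (2 * e + 3) <= w -> ~ has_suitable_core N v t.
Proof.
move=> leN lewv mw leN' m4 e3 [C /(core_restrict leN lewv)[rk dense]].
have := @no_dense_ranking _ _ rk m e; rewrite !card_ord => /(_ leN' m4 e3).
apply=> x T xT; have := dense x (~: (x |: T)).
rewrite !inE eqxx => /(_ isT); have := cardsC (x |: T); rewrite cardsU1 xT card_ord.
move: (#|rows_before _ _ _|) (#|~: (x |: T)|) => a b; move: mw; clear; lia.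
Qed.

(** * Construction of cores from weights *)

(* Ties in [w] are broken by the order of ['I_v]. *)
Lemma perm_of_weights v (w : 'I_v -> nat) :
  exists q : {perm 'I_v}, forall x y, w x < w y -> (q^-1)%g x < (q^-1)%g y.
Proof.
pose w' x := w x * v + x.
have w'_lt x y : w x < w y -> w' x < w' y.
  by rewrite /w'; have := ltn_ord x; nia.
have w'_inj : injective w'.
  move=> x y; have := w'_lt x y; have := w'_lt y x.
  case: (ltngtP (w x) (w y)) => [_ _ /(_ isT)|_ /(_ isT)|exy _ _]; try lia.
  by rewrite /w' exy => /addnI/val_inj.
pose below x := [set y | w' y < w' x].
have below_lt x : #|below x| < v.
  rewrite -[ltnRHS]card_ord -cardsT; apply/proper_card/properP.
  by split; [apply: subsetT | exists x; rewrite !inE // ltnn].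
have below_mono x y : w' x < w' y -> #|below x| < #|below y|.
  move=> lt; apply/proper_card/properP; split; last by exists x; rewrite !inE // ltnn.
  by apply/subsetP => z; rewrite !inE => /ltn_trans; apply.
pose f x := Ordinal (below_lt x).
have f_inj : injective f.
  move=> x y /(congr1 val) /= e; apply: w'_inj.
  by case: (ltngtP (w' x) (w' y)) => // /below_mono; rewrite e ltnn.
exists (perm f_inj)^-1%g => x y lt; rewrite invgK !permE /=.
exact/below_mono/w'_lt.
Qed.

Lemma suitable_core_of_weights (I : finType) N v t (w : I -> 'I_v -> nat) :
    t <= N.+1 -> #|I| <= N ->
    (forall x (U : {set 'I_v}), x \notin U -> t <= #|U| + #|rows_before w x U|) ->
  has_suitable_core N v t.
Proof.
move=> leN leI dense.
(* Surplus rows get constant weight 0: they are arbitrary, since only lower bounds on the counts are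
   required. *)
pose wt (i : 'I_N) x := if insub (i : nat) is Some j then w (@enum_val I predT j) x else 0.
have [C CP] := fin_all_exists (fun i => perm_of_weights (wt i)).
exists C; apply/suitable_coreP => // x U xU; apply: leq_trans (dense x U xU) _.
pose emb (j : I) : 'I_N := widen_ord leI (enum_rank j).
have emb_inj : injective emb by move=> a b /(congr1 val) /= /val_inj/enum_rank_inj.
rewrite leq_add2l -(card_imset _ emb_inj).
apply/subset_leq_card/subsetP => _ /imsetP[j /rows_beforeP lt ->].
apply/rows_beforeP => y yU; apply: CP.
have emb_rank : insub (emb j : nat) = Some (enum_rank j) := valK (enum_rank j).
by rewrite /wt emb_rank enum_rankK lt.
Qed.

(* The row of [(a, b)] starts with [a], [b]; then come [z0] and [z1], in an
   order that depends on whether [a < b]. *)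
Definition pair_weight v (z0 z1 : 'I_v) (ab : 'I_v * 'I_v) (x : 'I_v) : nat :=
  if x == ab.1 then 0 else if x == ab.2 then 1
  else if x == (if ab.1 < ab.2 then z0 else z1) then 2
  else if x \in [set z0; z1] then 3 else 4.

(** Let [T] be the complement of [x |: U]. All rows led by [x] count. If [x] is not in [Z], the rows
    of [(a, x)] with [a] in [T] are added. If [x] is in [Z], it leads one row more, and the
    [#|T| - 1] rows of [(a, b)] with a suitable fixed [a] in [T] and [b] in [T :\ a] suffice. *)
Lemma has_suitable_core_pairs v N (z0 z1 : 'I_v) :
    #|[set z0; z1]| < v -> (v - #|[set z0; z1]|) * v.-1 <= N ->
    2 * v - 2 - #|[set z0; z1]| <= N.+1 ->
  has_suitable_core N v (2 * v - 2 - #|[set z0; z1]|).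
Proof.
set Z := [set z0; z1].
move=> ltZ leI leN.
pose J := [set ab : 'I_v * 'I_v | (ab.2 \notin Z) && (ab.1 != ab.2)].
pose I := {ab : 'I_v * 'I_v | ab \in J}.
have cJ : #|J| = (v - #|Z|) * v.-1.
  have -> : #|J| = \sum_(b in ~: Z) \sum_(a in [set~ b]) 1.
    rewrite -sum1_card pair_big_dep /= (reindex (fun p : 'I_v * 'I_v => (p.2, p.1))) /=.
      by apply: eq_bigl => -[a b]; rewrite !inE.
    by exists (fun p : 'I_v * 'I_v => (p.2, p.1)) => -[].
  under eq_bigr do rewrite sum1_card cardsC1 card_ord.
  by rewrite sum_nat_const cardsCs setCK card_ord.
apply: (@suitable_core_of_weights I _ _ _ (fun i => pair_weight z0 z1 (val i))) => //.
  by rewrite card_sig (eq_card (_ : _ =i J)) ?cJ // => ?; rewrite inE.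
move=> x U xU.
pose T := ~: (x |: U).
have cT : #|U| + #|T| = v.-1.
  by have := cardsC (x |: U); rewrite cardsU1 xU card_ord -/T; lia.
have {cT} need k : v.-1 - #|Z| + #|T| <= k -> 2 * v - 2 - #|Z| <= #|U| + k by lia.
apply: need.
have -> : #|rows_before (fun i : I => pair_weight z0 z1 (val i)) x U|
        = #|rows_before (pair_weight z0 z1) x U :&: J|.
  rewrite -(card_imset _ val_inj); apply: eq_card => ab; apply/imsetP/setIP.
    by move=> [[ab' abJ] lt ->]; split=> //; move: lt; rewrite !inE.
  by case=> lt abJ; exists (exist _ ab abJ) => //; move: lt; rewrite !inE.
pose L := [set (x, b) | b in ~: (x |: Z)].
have LP : L \subset rows_before (pair_weight z0 z1) x U :&: J.
  apply/subsetP => _ /imsetP[b /setCP/negP + ->]; rewrite in_setU1 negb_or => /andP[bx bZ].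
  rewrite inE [_ \in J]inE /= bZ eq_sym bx !andbT; apply/rows_beforeP => y yU.
  rewrite /pair_weight /= eqxx ifF; first by case: ifP => // _; case: ifP => // _; case: ifP.
  by apply: contraNF xU => /eqP <-.
have cL : #|L| = v - #|x |: Z|.
  by rewrite card_imset => [|? ? []//]; rewrite cardsCs setCK card_ord.
suff [M [sM dM cM]] : exists M : {set 'I_v * 'I_v},
    [/\ M \subset rows_before (pair_weight z0 z1) x U :&: J, [disjoint L & M] &
        #|T| <= #|M| + (x \in Z)].
  have := subset_leq_card (_ : L :|: M \subset rows_before (pair_weight z0 z1) x U :&: J).
  rewrite subUset LP sM cardsU (disjoint_setI0 dM) cards0 subn0 => /(_ isT)/(leq_trans _); apply.
  move: cM ltZ; rewrite cL cardsU1; case: (x \in Z) => /=; move: #|M| #|T| #|Z|; lia.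
have [xZ|xZ] := boolP (x \in Z); last first.
  exists [set (a, x) | a in T]; rewrite addn0; split.
  - apply/subsetP => _ /imsetP[a aT ->]; move: aT; rewrite 3!inE negb_or => /andP[ax aU].
    rewrite inE; apply/andP; split; last by rewrite inE /= xZ.
    apply/rows_beforeP => y yU; rewrite /pair_weight /= eqxx.
    rewrite eq_sym (negPf ax) ifF; last by apply: contraNF aU => /eqP <-.
    rewrite ifF; last by apply: contraNF xU => /eqP <-.
    by case: ifP => // _; case: ifP.
  - rewrite -setI_eq0; apply/eqP/setP => ab; rewrite !inE.
    apply/negP => /andP[/imsetP[b _ ->] /imsetP[a]]; rewrite !inE => aT [e _].
    by move: aT; rewrite -e eqxx.
  - by rewrite card_imset // => ? ? [].
have [->|[a0 a0T]] := set_0Vmem T.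
  by exists set0; rewrite cards0 sub0set; split=> //; rewrite disjoint_sym disjoints_subset sub0set.
(* If [T] contains the other element of [Z], this is [a], and no element of [Z] is left in [U].
   Otherwise [a] is the least element of [T] for [x = z0] and the greatest for [x = z1], which makes
   [x] third in the row of [(a, b)]. *)
have [a [aT aP]] : exists a, a \in T /\ forall b, b \in T -> b != a ->
    b \notin Z /\ ((a \in Z) || (x == (if a < b then z0 else z1))).
  have Tx b : b \in T -> b != x by rewrite !inE negb_or => /andP[].
  have [/existsP[a /andP[aT aZ]]|/existsPn TZ] := boolP [exists a in T, a \in Z].
    exists a; split=> // b bT ba; rewrite aZ; split=> //.
    apply: contra ba => bZ; move: xZ aZ bZ (Tx a aT) (Tx b bT); rewrite !inE.
    by do 3![case/orP=> /eqP->]; rewrite ?eqxx.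
  have TZ' b : b \in T -> b \notin Z by move=> bT; have := TZ b; rewrite bT.
  move: xZ; rewrite !inE => /orP[] /eqP xz.
    case: (@arg_minnP _ a0 (mem T) (@nat_of_ord v) a0T) => a aT amin.
    exists a; split=> // b bT ba; split; first exact: TZ'.
    have -> : a < b by rewrite ltn_neqAle (amin b bT) andbT (inj_eq val_inj) eq_sym.
    by rewrite xz eqxx orbT.
  case: (@arg_maxnP _ a0 (mem T) (@nat_of_ord v) a0T) => a aT amax.
  exists a; split=> // b bT ba; split; first exact: TZ'.
  by rewrite ltnNge (amax b bT : b <= a) xz eqxx orbT.
exists [set (a, b) | b in T :\ a]; split.
- apply/subsetP => _ /imsetP[b /setD1P[ba bT] ->]; have [bZ az] := aP b bT ba.
  rewrite inE; apply/andP; split; last by rewrite inE /= bZ eq_sym.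
  have ax : x != a by apply: contraTneq aT => <-; rewrite !inE eqxx.
  have bx : x != b by apply: contraTneq bT => <-; rewrite !inE eqxx.
  apply/rows_beforeP => y yU.
  have ya : y != a by apply: contraTneq aT => <-; rewrite !inE yU orbT.
  have yb : y != b by apply: contraTneq bT => <-; rewrite !inE yU orbT.
  rewrite /pair_weight /= (negPf ax) (negPf bx) (negPf ya) (negPf yb).
  have yx : y != x by apply: contraNneq xU => <-.
  have [|xp] := boolP (x == (if a < b then z0 else z1)).
    by move=> /eqP <-; rewrite (negPf yx); case: ifP.
  rewrite (negPf xp) orbF in az.
  have yZ : y \notin Z.
    apply/negP; move: xZ az; rewrite !inE.
    move=> xZ aZ yZ; move: yx ya ax; case/orP: xZ => /eqP->; case/orP: aZ => /eqP->;
      case/orP: yZ => /eqP->; by rewrite ?eqxx.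
  have -> : y == (if a < b then z0 else z1) = false.
    by apply: contraNF yZ => /eqP->; rewrite !inE; case: ifP; rewrite eqxx ?orbT.
  by rewrite -/Z (negPf yZ) xZ.
- rewrite -setI_eq0; apply/eqP/setP => ab; rewrite !inE.
  apply/negP => /andP[/imsetP[b _ ->] /imsetP[b' _ [e _]]].
  by move: aT; rewrite !inE -e eqxx.
- by rewrite card_imset => [|? ? []//]; rewrite (cardsD1 a T) aT addnC.
Qed.

(** * The logarithmic bound and the values of SCN *)

Lemma leq_exp3_of_ln (R : realType) (l s : nat) :
    0 < s -> (l%:R <= ln (s%:R : R) / (6 * ln (3 : R)))%R -> 3 ^ (6 * l) <= s.
Proof.
move=> s0; have ln3 : (0 < ln (3 : R))%R by rewrite ln_gt0 // ltr1n.
rewrite ler_pdivlMr ?mulr_gt0 ?ltr0n // => le.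
rewrite -(ler_nat R) -ler_ln ?posrE ?ltr0n ?expn_gt0 //.
by rewrite natrX lnXn ?ltr0n // -[(_ *+ (6 * l))%R]mulr_natl natrM -mulrA mulrCA.
Qed.

(** After squaring, the exponent [4 * l + 2 * k] is at most [2 * k + 6 * l], and each of the two
    powers is at most [s]. *)
Lemma leq_exp3_eventually k l s :
  3 ^ (2 * k) <= s -> 3 ^ (6 * l) <= s -> 3 ^ (2 * l + k) <= s.
Proof.
move=> lek lel; rewrite -leq_sqr -expnM.
apply: (@leq_trans (3 ^ (2 * k) * 3 ^ (6 * l))).
  by rewrite -expnD leq_exp2l //; lia.
by rewrite expnS expn1 leq_mul.
Qed.

Lemma is_SCN_odd s l : 0 < s -> 3 ^ (2 * l + 11) <= s ->
  is_SCN (2 * s + 1) ((s + 1) ^ 2 + l) (s + 2).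
Proof.
move=> s0 les; split; first by lia.
(* Equal [z0] and [z1] make [Z] a singleton, with [(s + 1) ^ 2] pairs. *)
- pose z : 'I_(s + 2) := cast_ord (esym (addn2 s)) ord0.
  have := @has_suitable_core_pairs (s + 2) ((s + 1) ^ 2 + l) z z.
  rewrite setUid cards1 (_ : 2 * (s + 2) - 2 - 1 = 2 * s + 1); last by lia.
  by apply; [lia | nia | nia].
- move=> v' _ coreC; rewrite leqNgt; apply/negP => lt.
  (* [(s + 1) ^ 2 + l = (s - 1) * (s + 3) + (l + 4)]. *)
  apply: (@core_size_bound _ _ _ (s + 3) (s - 1) (l + 4) _ _ _ _ _ _ coreC).
  + by nia.
  + by lia.
  + by lia.
  + by nia.
  + by lia.
  + rewrite (_ : 2 * (l + 4) + 3 = 2 * l + 11); last by lia.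
    exact: leq_trans les (leq_addr _ _).
Qed.

Lemma is_SCN_even s l : 1 < s -> 3 ^ (2 * l + 15) <= s ->
  is_SCN (2 * s) (s * (s + 1) + l) (s + 2).
Proof.
move=> s1 les; split; first by lia.
- pose z0 : 'I_(s + 2) := cast_ord (esym (addn2 s)) ord0.
  pose z1 : 'I_(s + 2) := cast_ord (esym (addn2 s)) ord_max.
  have := @has_suitable_core_pairs (s + 2) (s * (s + 1) + l) z0 z1.
  rewrite cards2 (_ : z0 != z1 = true) //= (_ : 2 * (s + 2) - 2 - 2 = 2 * s); last by lia.
  by apply; [lia | nia | nia].
- move=> v' _ coreC; rewrite leqNgt; apply/negP => lt.
  (* [s * (s + 1) + l = (s - 2) * (s + 3) + (l + 6)]. *)
  apply: (@core_size_bound _ _ _ (s + 3) (s - 2) (l + 6) _ _ _ _ _ _ coreC).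
  + by nia.
  + by lia.
  + by lia.
  + by nia.
  + by lia.
  + rewrite (_ : 2 * (l + 6) + 3 = 2 * l + 15); last by lia.
    exact: leq_trans les (leq_addr _ _).
Qed.

Theorem theorem4 (R : realType) :
  (forall l : nat -> nat,
    (forall s : nat, 0 < s ->
      ((l s)%:R <= ln (s%:R : R) / (6 * ln (3 : R)))%R) ->
    exists s0 : nat, forall s : nat, s0 <= s ->
      is_SCN (2 * s + 1) ((s + 1) ^ 2 + l s) (s + 2)) /\
  (forall l : nat -> nat,
    (forall s : nat, 0 < s ->
      ((l s)%:R <= ln (s%:R : R) / (6 * ln (3 : R)))%R) ->
    exists s0 : nat, forall s : nat, s0 <= s ->
      is_SCN (2 * s) (s * (s + 1) + l s) (s + 2)).
Proof.
have threshold k (l : nat -> nat) :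
    (forall s : nat, 0 < s -> ((l s)%:R <= ln (s%:R : R) / (6 * ln (3 : R)))%R) ->
    exists s0, forall s, s0 <= s -> 1 < s /\ 3 ^ (2 * l s + k) <= s.
  move=> lel; exists (maxn 2 (3 ^ (2 * k))) => s; rewrite geq_max => /andP[s1 les].
  split=> //; apply: leq_exp3_eventually => //.
  exact: leq_exp3_of_ln (ltnW s1) (lel s (ltnW s1)).
split=> l lel.
  have [s0 s0P] := threshold 11 l lel; exists s0 => s /s0P[s1 les].
  exact: is_SCN_odd (ltnW s1) les.
have [s0 s0P] := threshold 15 l lel; exists s0 => s /s0P[s1 les].
exact: is_SCN_even s1 les.
Qed.
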